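(* Let $K$ and $H$ be finite graphs with disjoint edge sets that meet only in two vertices $u_1,u_2$, and let $U=\{u_1,u_2\}$. Then, as an identity of rational functions in $t,x,y$ (with $t\neq 0,1$), $$f(K\cup_UH)=\frac{f(K/C)f(H/C)}{t-1}-\frac{f(K/C)f(H)}{t(t-1)}-\frac{f(K)f(H/C)}{t(t-1)}+\frac{f(K)f(H)}{t(t-1)}.$$
   Context: Graphs are finite and may have loops and multiple edges. $K\cup_U H$ is the graph with vertex set $V(K)\cup V(H)$, where $V(K)\cap V(H)=U$, and edge set $E(K)\sqcup E(H)$. $C=\{\{u_1,u_2\}\}$ is the one-block partition of $U$, and $K/C$ (resp. $H/C$) is the graph obtained from $K$ (resp. $H$) by identifying $u_1$ and $u_2$, keeping all edges. The Negami polynomial $f(G)=f(G;t,x,y)$, a polynomial in the indeterminates $t,x,y$, is the graph invariant determined by $f(\overline K_n;t,x,y)=t^n$, where $\overline K_n$ is the graph with $n$ vertices and no edges, and, for every edge $e$ of $G$, $f(G;t,x,y)=x\,f(G/e;t,x,y)+y\,f(G-e;t,x,y)$, where $G-e$ is deletion, $G/e$ is contraction (identify the endpoints of $e$ and remove $e$, keeping all other edges), and $G/e=G-e$ if $e$ is a loop. *)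

(* Defs.v *)
From HB Require Import structures.
From mathcomp Require Import all_boot all_order all_algebra.
From mathcomp Require Import mpoly.

Set Implicit Arguments.
Unset Strict Implicit.
Unset Printing Implicit Defensive.

Import GRing.Theory.
Local Open Scope ring_scope.

Notation "p %:F" := (@tofrac _ p).

(* Finite undirected multigraphs whose vertices and edges are taken from        *)
(* ambient finite types T and E.  Loops are the edges with one endpoint,        *)
(* parallel edges are edges with equal endpoint sets.  The values of ends       *)
(* outside eset are junk.                                                       *)
Record mgraph (T E : finType) := MGraph {
  vset : {set T};
  eset : {set E};
  ends : E -> {set T};
  ends_wf : forall e, e \in eset -> (ends e \subset vset) && (0 < #|ends e| <= 2)%N
}.

Definition isomorphic (T E T' E' : finType)
    (G : mgraph T E) (G' : mgraph T' E') : Prop :=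
  exists (phi : T -> T') (psi : E -> E'),
    [/\ {in vset G &, injective phi} /\ phi @: vset G = vset G',
        {in eset G &, injective psi} /\ psi @: eset G = eset G'
      & {in eset G, forall e, ends G' (psi e) = phi @: ends G e}].

Section Operations.
Variables T E : finType.
Implicit Types (G K H : mgraph T E) (S : {set T}) (e : E).

Fact delete_wf G e e' : e' \in eset G :\ e ->
  (ends G e' \subset vset G) && (0 < #|ends G e'| <= 2)%N.
Proof. by case/setD1P=> _; apply: ends_wf. Qed.

Definition delete G e := MGraph (@delete_wf G e).

(* All vertices of S are replaced by a single one of them, which serves as      *)
(* the name of the new vertex.                                                  *)
Definition rep S (v : T) : T :=
  if v \in S then odflt v [pick w in S] else v.

Fact identify_wf G S e : e \in eset G ->
  (rep S @: ends G e \subset rep S @: vset G)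
    && (0 < #|rep S @: ends G e| <= 2)%N.
Proof.
case/ends_wf/and3P=> sub gt0 le2; rewrite imsetS //=.
rewrite (leq_trans (leq_imset_card _ _) le2) andbT.
case/card_gt0P: gt0 => v ve; apply/card_gt0P.
by exists (rep S v); apply: imset_f.
Qed.

Definition identify G S := MGraph (@identify_wf G S).

Definition is_loop G e := #|ends G e| == 1%N.

Definition contract G e :=
  if is_loop G e then delete G e else identify (delete G e) (ends G e).

Fact union_wf K H e : e \in eset K :|: eset H ->
  ((if e \in eset K then ends K e else ends H e) \subset vset K :|: vset H)
    && (0 < #|if e \in eset K then ends K e else ends H e| <= 2)%N.
Proof.
rewrite inE; case: ifP => [eK _ | _ /= eH].
  by case/andP: (ends_wf eK) => sub ->; rewrite andbT subsetU ?sub.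
by case/andP: (ends_wf eH) => sub ->; rewrite andbT subsetU ?sub ?orbT.
Qed.

(* Only meant for graphs with disjoint edge sets. *)
Definition union K H := MGraph (@union_wf K H).

End Operations.

(* The indeterminates t, x, y of Z[t, x, y]. *)
Definition tI : {mpoly int[3]} := 'X_(@Ordinal 3 0 isT).
Definition xI : {mpoly int[3]} := 'X_(@Ordinal 3 1 isT).
Definition yI : {mpoly int[3]} := 'X_(@Ordinal 3 2 isT).

Record is_negami (f : forall T E : finType, mgraph T E -> {mpoly int[3]}) :
    Prop := IsNegami {
  negami_iso : forall (T E T' E' : finType)
      (G : mgraph T E) (G' : mgraph T' E'),
    isomorphic G G' -> f T E G = f T' E' G';
  negami_edgeless : forall (T E : finType) (G : mgraph T E),
    eset G = set0 -> f T E G = tI ^+ #|vset G|;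
  negami_edge : forall (T E : finType) (G : mgraph T E) (e : E),
    e \in eset G ->
    f T E G = xI * f T E (contract G e) + yI * f T E (delete G e)
}.

(* Exactly one invariant satisfies is_negami. *)
Section WellDefined.

Lemma negami_unique f f' : is_negami f -> is_negami f' ->
  forall (T E : finType) (G : mgraph T E), f T E G = f' T E G.
Proof.
move=> hf hf' T E G; have [n] := ubnP #|eset G|.
elim: n G => // n IHn G leGn.
have [G0 | [e eG]] := set_0Vmem (eset G).
  by rewrite (negami_edgeless hf) // (negami_edgeless hf').
have ltD : (#|eset (delete G e)| < n)%N.
  by move: leGn; rewrite (cardsD1 e) eG.
have ltC : (#|eset (contract G e)| < n)%N by rewrite /contract; case: ifP.
by rewrite (negami_edge hf eG) (negami_edge hf' eG) !IHn.
Qed.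

Section Components.
Variables T E : finType.
Implicit Types (G : mgraph T E) (Y : {set E}).

Definition adj G Y : rel T :=
  fun u v => [exists e in Y, (u \in ends G e) && (v \in ends G e)].

Definition comp G Y (v : T) : {set T} := [set w | connect (adj G Y) v w].

Definition ncomp G Y : nat := #|comp G Y @: vset G|.

Lemma adj_sym G Y : connect_sym (adj G Y).
Proof.
apply: sym_connect_sym => u v; apply: eq_existsb => e.
by rewrite (andbC (u \in _)).
Qed.

Lemma comp_eqP G Y u v : reflect (comp G Y u = comp G Y v)
  (connect (adj G Y) u v).
Proof.
apply: (iffP idP) => [cuv | /setP/(_ v)]; last by rewrite !inE connect0.
by apply/setP => w; rewrite !inE (same_connect (@adj_sym G Y) cuv).
Qed.

Definition statesum G : {mpoly int[3]} :=
  \sum_(Y : {set E} | Y \subset eset G)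
    tI ^+ ncomp G Y * xI ^+ #|Y| * yI ^+ #|eset G :\: Y|.

End Components.

Lemma eq_ncomp (T E T' E' : finType) (G : mgraph T E) (G' : mgraph T' E')
    Y Y' (phi : T -> T') :
  phi @: vset G = vset G' ->
  {in vset G &, forall u v,
     connect (adj G Y) u v = connect (adj G' Y') (phi u) (phi v)} ->
  ncomp G Y = ncomp G' Y'.
Proof.
move=> eqV eqc; pose img (A : {set T}) := \bigcup_(v in A :&: vset G)
  comp G' Y' (phi v).
have imgE v : v \in vset G -> img (comp G Y v) = comp G' Y' (phi v).
  move=> vG; apply/setP => w; apply/bigcupP/idP => [[u] | wv]; last first.
    by exists v; rewrite // !inE connect0.
  rewrite !inE => /andP[cvu uG]; rewrite eqc // in cvu.
  by apply: connect_trans.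
rewrite /ncomp -eqV -imset_comp.
have -> : (comp G' Y' \o phi) @: vset G = img @: (comp G Y @: vset G).
  by rewrite -imset_comp; apply: eq_in_imset => v vG /=; rewrite imgE.
rewrite [RHS]card_in_imset // => _ _ /imsetP[u uG ->] /imsetP[v vG ->].
by rewrite !imgE // => /comp_eqP; rewrite -eqc // => /comp_eqP.
Qed.

Lemma ncomp_iso (T E T' E' : finType) (G : mgraph T E) (G' : mgraph T' E')
    (Y : {set E}) (phi : T -> T') (psi : E -> E') :
  {in vset G &, injective phi} -> phi @: vset G = vset G' ->
  {in eset G, forall e, ends G' (psi e) = phi @: ends G e} ->
  Y \subset eset G -> ncomp G Y = ncomp G' (psi @: Y).
Proof.
move=> injV eqV eqe sYG; apply: (eq_ncomp eqV) => u v uG vG.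
apply/idP/idP.
  case/connectP=> p pth ->; elim: p u pth {uG} => //= w p IHp u /andP[uw pth].
  apply: connect_trans (IHp w pth); apply: connect1.
  case/exists_inP: uw => e eY /andP[ue we]; apply/exists_inP.
  exists (psi e); first exact: imset_f.
  by rewrite eqe ?(subsetP sYG) // !imset_f.
case/connectP=> p pth lp.
elim: p u uG pth lp => [|w' p IHp] u uG /= => [_ /(injV _ _ vG uG) -> // |].
case/andP=> /exists_inP[_ /imsetP[e eY ->] /andP[]].
have eG := subsetP sYG _ eY; case/andP: (ends_wf eG) => /subsetP se _.
rewrite eqe // => /imsetP[u1 u1e eq_u] /imsetP[w we defw] pth lp; subst w'.
have {u1 u1e eq_u} ue : u \in ends G e by rewrite (injV _ _ uG (se _ u1e) eq_u).
apply: connect_trans (IHp w (se w we) pth lp).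
by apply/connect1/exists_inP; exists e; rewrite // ue.
Qed.

Lemma statesum_iso (T E T' E' : finType) (G : mgraph T E)
    (G' : mgraph T' E') : isomorphic G G' -> statesum G = statesum G'.
Proof.
case=> phi [psi [[injV eqV] [injE eqE] eqe]].
pose h (Y : {set E}) := psi @: Y.
pose h' (Y' : {set E'}) := [set e in eset G | psi e \in Y'].
have hK (Y : {set E}) : Y \subset eset G -> h' (h Y) = Y.
  move=> /subsetP sY; apply/setP => e; rewrite !inE.
  apply/andP/idP => [[eG /imsetP[e' e'Y eq]] | eY].
    by rewrite (injE _ _ eG (sY _ e'Y) eq).
  by rewrite sY // imset_f.
have h'K (Y' : {set E'}) : Y' \subset eset G' -> h (h' Y') = Y'.
  rewrite -eqE => /subsetP sY; apply/setP => e'.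
  apply/imsetP/idP => [[e /setIdP[_ eY] ->] // | e'Y].
  by case/imsetP: (sY _ e'Y) => e eG def; exists e; rewrite // inE eG -def.
rewrite /statesum (reindex_onto h h') => [|Y']; last exact: h'K.
apply: eq_big => [Y | Y sY].
  apply/idP/andP=> [sY | [_ /eqP <-]]; last first.
    by apply/subsetP => e /setIdP[].
  by rewrite -eqE imsetS // hK.
have cardY : #|psi @: Y| = #|Y|.
  by rewrite card_in_imset // => e e' /(subsetP sY) eG /(subsetP sY); apply: injE.
rewrite (ncomp_iso injV eqV eqe sY) cardsDS // cardsDS; last first.
  by rewrite -eqE imsetS.
by rewrite -eqE card_in_imset // cardY.
Qed.

Lemma rep_in (T : finType) (S : {set T}) v : v \in S -> rep S v \in S.
Proof. by rewrite /rep => vS; rewrite vS; case: pickP => [w | /(_ v)/idP]. Qed.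

Lemma rep_out (T : finType) (S : {set T}) v : v \notin S -> rep S v = v.
Proof. by rewrite /rep => /negbTE->. Qed.

Lemma rep_eq (T : finType) (S : {set T}) u v :
  u \in S -> v \in S -> rep S u = rep S v.
Proof.
by rewrite /rep => uS vS; rewrite uS vS; case: pickP => // /(_ v)/idP.
Qed.

Section DeletionContraction.
Variables (T E : finType) (G : mgraph T E) (e : E) (Y : {set E}).
Hypotheses (eG : e \in eset G) (eY : e \notin Y).

Lemma ncomp_loop : is_loop G e -> ncomp G (e |: Y) = ncomp (delete G e) Y.
Proof.
case/cards1P=> a ea; apply: (@eq_ncomp _ _ _ _ _ _ _ _ id) => [|u v _ _].
  exact: imset_id.
apply/idP/idP; last first.
  apply: connect_sub => {}u {}v /exists_inP[e' e'Y uv]; apply/connect1/exists_inP.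
  by exists e'; rewrite // !inE e'Y orbT.
apply: connect_sub => {}u {}v /exists_inP[e' /setU1P[-> | e'Y] uv].
  by move: uv; rewrite ea !inE => /andP[/eqP-> /eqP->]; apply: connect0.
by apply/connect1/exists_inP; exists e'.
Qed.

Lemma ncomp_nonloop :
  ncomp G (e |: Y) = ncomp (identify (delete G e) (ends G e)) Y.
Proof.
set S := ends G e; set G1 := identify _ _.
have cS u v : u \in S -> v \in S -> connect (adj G (e |: Y)) u v.
  by move=> uS vS; apply/connect1/exists_inP; exists e; rewrite ?setU11 ?uS.
have crep u : connect (adj G (e |: Y)) u (rep S u).
  have [uS | uS] := boolP (u \in S); first by rewrite cS ?rep_in.
  by rewrite rep_out.
apply: (@eq_ncomp _ _ _ _ _ _ _ _ (rep S)) => // u v _ _; apply/idP/idP.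
  case/connectP=> p pth ->; elim: p u pth => //= w p IHp u /andP[uw pth].
  apply: connect_trans (IHp w pth).
  case/exists_inP: uw => e' /setU1P[-> | e'Y] /andP[ue we].
    by rewrite (rep_eq ue we).
  by apply/connect1/exists_inP; exists e'; rewrite //= !imset_f.
move=> c; apply: connect_trans (crep u) _.
rewrite (@adj_sym _ _ G) ; apply: connect_trans (crep v) _.
rewrite (@adj_sym _ _ G); move: c; apply: connect_sub => {}u {}v.
case/exists_inP=> e' e'Y /andP[/imsetP[a ae ->] /imsetP[b be ->]].
apply: connect_trans (crep b); rewrite (@adj_sym _ _ G).
apply: connect_trans (crep a); rewrite (@adj_sym _ _ G).
by apply/connect1/exists_inP; exists e'; rewrite ?ae // !inE e'Y orbT.
Qed.

Lemma ncomp_contract : ncomp G (e |: Y) = ncomp (contract G e) Y.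
Proof.
by rewrite /contract; case: ifP => [/ncomp_loop | _]; last exact: ncomp_nonloop.
Qed.

End DeletionContraction.

Lemma statesum_edge (T E : finType) (G : mgraph T E) e : e \in eset G ->
  statesum G = xI * statesum (contract G e) + yI * statesum (delete G e).
Proof.
move=> eG; have eC : eset (contract G e) = eset G :\ e.
  by rewrite /contract; case: ifP.
rewrite /statesum (bigID (fun Y : {set E} => e \in Y)) /= eC !big_distrr /=.
congr (_ + _).
  rewrite (reindex_onto (fun Y => e |: Y) (fun Y => Y :\ e)) /=; last first.
    by move=> Y /andP[_ eY]; rewrite setD1K.
  apply: eq_big => [Y | Y /andP[/andP[sY _] /eqP defY]].
    rewrite setU11 andbT subsetD1 subUset sub1set eG /=.
    congr (_ && _); apply/eqP/idP => [<- | eY]; last by rewrite setU1K.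
    by rewrite !inE eqxx.
  have eY : e \notin Y by rewrite -defY !inE eqxx.
  rewrite ncomp_contract // cardsU1 eY exprS -setDDl.
  by rewrite mulrCA -!mulrA.
apply: eq_big => [Y | Y /andP[sY eY]]; first by rewrite subsetD1.
rewrite [X in yI ^+ X](cardsD1 e) !inE eG eY /= exprS.
rewrite setDDl setUC -setDDl.
by rewrite mulrCA.
Qed.

Lemma statesum_negami : is_negami statesum.
Proof.
split=> [T E T' E' G G' | T E G G0 | T E G e]; first exact: statesum_iso.
  rewrite /statesum G0 (big_pred1 set0) => [|Y]; last by rewrite subset0.
  rewrite setD0 cards0 !expr0 !mulr1; congr (_ ^+ _).
  rewrite /ncomp card_in_imset // => u v uG vG /comp_eqP.
  case/connectP=> [[|w p] /= pth -> //]; case/andP: pth.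
  by case/exists_inP=> e; rewrite inE.
exact: statesum_edge.
Qed.

Lemma negami_exists : exists f, is_negami f.
Proof. by exists statesum; apply: statesum_negami. Qed.

End WellDefined.

(* Main.v *)
Require Import Defs.
From HB Require Import structures.
From mathcomp Require Import all_boot all_order all_algebra.
From mathcomp Require Import mpoly.
From mathcomp Require Import ring.

(** Expand every Negami polynomial as a state sum: each spanning edge set [Y]
    contributes [x^#|Y| y^#|E \ Y|] times [t] to the number of components of
    the spanning subgraph [Y].  Sort these components into the free ones,
    which avoid [U = {u1, u2}], and the anchored ones, which meet [U].

    - The free components are the same vertex sets in [K] and in [K/C]
      ([free_comps_identify]), and those of a state of [K \cup_U H] are those
      of its restrictions to [K] and to [H], without overlap
      ([card_free_comps_union]).  Thus the free weight of a state, where only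
      free components are counted, does not see the identification and is
      multiplicative under gluing ([free_weight_union]).
    - There is one anchored component if the state joins [u1] to [u2], and
      there are two otherwise; in [K/C] there is always one.  A state of the
      union joins [u1] to [u2] exactly when its restriction to [K] or its
      restriction to [H] does ([connect_union]).

    Let [c] and [d] be the total free weights of the joining and of the
    non-joining states of [K], and [c'], [d'] those of [H].  Then
      [f(K) = t c + t^2 d],  [f(K/C) = t c + t d],
      [f(K \cup_U H) = t (c c' + c d' + d c') + t^2 d d'],
    and similarly for [H].  Since [t] and [t - 1] are nonzero, the first two
    equations determine [c] and [d], and substituting them into the third one
    gives the formula ([gluing_identity]). *)

Set Implicit Arguments.
Unset Strict Implicit.
Unset Printing Implicit Defensive.

Import GRing.Theory.
Local Open Scope ring_scope.

(* Otherwise [comp] would be the composition of functions. *)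
Local Notation comp := Defs.comp.

(** * Components of a state *)

Section Components.
Variables T E : finType.
Implicit Types (G K H : mgraph T E) (Y Z : {set E}) (A U : {set T}).

Lemma adj_vset G Y v w : Y \subset eset G -> adj G Y v w ->
  (v \in vset G) && (w \in vset G).
Proof.
move=> /subsetP sY /exists_inP[e /sY eG /andP[ve we]].
by case/andP: (ends_wf eG) => /subsetP sV _; rewrite !sV.
Qed.

Lemma comp_refl G Y v : v \in comp G Y v.
Proof. by rewrite inE connect0. Qed.

Lemma comp_step G Y v w z : w \in comp G Y v -> adj G Y w z -> z \in comp G Y v.
Proof. by rewrite !inE => cvw wz; apply: connect_trans cvw (connect1 wz). Qed.

Lemma comp_subclosed G Y A v : v \in A ->
  (forall w z, w \in A -> adj G Y w z -> z \in A) -> comp G Y v \subset A.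
Proof.
move=> vA clA; apply/subsetP=> w; rewrite inE => /connectP[p pth ->].
elim: p v vA pth => //= z p IHp v vA /andP[vz].
by apply: IHp; apply: clA vA vz.
Qed.

Lemma comp_sub_vset G Y v : Y \subset eset G -> v \in vset G ->
  comp G Y v \subset vset G.
Proof.
move=> sY vG; apply: comp_subclosed => // w z _ /(adj_vset sY).
by case/andP.
Qed.

(** Used below for pairs of graphs that differ only near the interface [U]:
    a walk that starts in a component never leaves it, so it cannot notice
    the difference. *)
Lemma comp_local G Y G' Y' v :
  (forall w z, w \in comp G Y v -> adj G Y w z = adj G' Y' w z) ->
  comp G' Y' v = comp G Y v.
Proof.
move=> eqadj; apply/eqP; rewrite eqEsubset; apply/andP; split.
  apply: comp_subclosed (comp_refl _ _ _) _ => w z wA.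
  by rewrite -eqadj //; apply: comp_step.
(* Walks of G starting at v must be followed inside both components at once. *)
have /subsetP sub : comp G Y v \subset comp G Y v :&: comp G' Y' v.
  apply: comp_subclosed => [|w z /setIP[wA wA'] wz]; first by rewrite inE !comp_refl.
  by rewrite inE (comp_step wA wz) (comp_step wA') // -eqadj.
by apply/subsetP=> w /sub /setIP[].
Qed.

Definition free_comps U G Y : {set {set T}} :=
  [set A in comp G Y @: vset G | [disjoint A & U]].

Lemma free_compsP U G Y A :
  reflect (exists v, [/\ v \in vset G, A = comp G Y v & [disjoint A & U]])
          (A \in free_comps U G Y).
Proof.
rewrite inE; apply: (iffP andP) => [[/imsetP[v vG ->] dU] | [v [vG -> dU]]].
  by exists v.
by rewrite imset_f.
Qed.

(** The anchored components are counted by the vertices of [U]: such a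
    component is the component of any vertex of [U] that it contains. *)
Lemma ncomp_free_anchored U G Y : Y \subset eset G ->
  ncomp G Y = (#|free_comps U G Y| + #|comp G Y @: (U :&: vset G)|)%N.
Proof.
move=> sY; rewrite /ncomp -(cardsID [set A : {set T} | [disjoint A & U]]).
congr (_ + _)%N; first by rewrite /free_comps setIdE.
congr #|pred_of_set _|; apply/setP=> A; rewrite !inE.
apply/andP/imsetP=> [[]|[v /setIP[vU vG] ->]]; last first.
  split; last exact: imset_f.
  by apply/pred0Pn; exists v; rewrite /= comp_refl.
case/pred0Pn=> w /andP[/= wA wU] /imsetP[v vG defA].
have wv : w \in comp G Y v by rewrite -defA.
exists w; first by rewrite inE wU (subsetP (comp_sub_vset sY vG)).
by rewrite defA; apply/comp_eqP; rewrite inE in wv.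
Qed.

(** * Identifying the vertices of U *)

(** The vertex naming the identified one lies in [U], so at a component
    that avoids [U] on either side the two adjacency relations agree. *)
Lemma comp_identify U G Y v :
    [disjoint comp G Y v & U] || [disjoint comp (identify G U) Y v & U] ->
  comp (identify G U) Y v = comp G Y v.
Proof.
have outP (A : {set T}) w : [disjoint A & U] -> w \in A -> w \notin U.
  by move=> dA wA; rewrite (disjointFr dA wA).
have repK a : rep U a \notin U -> rep U a = a.
  by move=> raU; apply/rep_out/(contraNN _ raU)/rep_in.
case/orP=> dU; last symmetry; apply: comp_local => w z wA.
  have wU := outP _ _ dU wA; apply/idP/idP=> [wz | ].
    have zU := outP _ _ dU (comp_step wA wz).
    case/exists_inP: wz => e eY /andP[we ze]; apply/exists_inP; exists e => //=.
    by rewrite -[w](rep_out wU) -[z](rep_out zU) !imset_f.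
  case/exists_inP=> e eY /andP[/imsetP[a ae defw] /imsetP[b be ->]].
  have {}defw : w = a by rewrite defw repK // -defw.
  have wb : adj G Y w b by apply/exists_inP; exists e; rewrite // defw ae.
  by rewrite (rep_out (outP _ _ dU (comp_step wA wb))).
have wU := outP _ _ dU wA; apply/idP/idP=> [wz | ].
  have zU := outP _ _ dU (comp_step wA wz).
  case/exists_inP: wz => e eY /andP[/imsetP[a ae defw] /imsetP[b be defz]].
  apply/exists_inP; exists e => //.
  by rewrite defw repK -?defw // defz repK -?defz // ae.
case/exists_inP=> e eY /andP[we ze].
have wz : adj (identify G U) Y w (rep U z).
  by apply/exists_inP; exists e; rewrite //= -{1}[w](rep_out wU) !imset_f.
by rewrite -(repK z) // (outP _ _ dU (comp_step wA wz)).
Qed.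

Lemma free_comps_identify U G Y :
  free_comps U (identify G U) Y = free_comps U G Y.
Proof.
apply/setP=> A; apply/free_compsP/free_compsP=> -[v [vG -> dU]].
  have vU : v \notin U by rewrite (disjointFr dU (comp_refl _ _ _)).
  have eqA := comp_identify (introT orP (or_intror dU)).
  case/imsetP: vG => a aG defv; exists v; split=> //.
  by rewrite defv rep_out //; apply: contraNN vU => /rep_in; rewrite -defv.
have vU : v \notin U by rewrite (disjointFr dU (comp_refl _ _ _)).
have eqA := comp_identify (introT orP (or_introl dU)).
by exists v; split; rewrite ?eqA // -(rep_out vU) imset_f.
Qed.

(** * Gluing along U *)

Section Gluing.
Variables (K H : mgraph T E) (U : {set T}) (Y Z : {set E}).
Hypotheses (hV : vset K :&: vset H = U) (hE : [disjoint eset K & eset H]).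
Hypotheses (sY : Y \subset eset K) (sZ : Z \subset eset H).

Lemma adj_union v w :
  adj (union K H) (Y :|: Z) v w = adj K Y v w || adj H Z v w.
Proof.
apply/exists_inP/orP=> [[e /setUP[eY|eZ]] | [|] /exists_inP[e eS vwe]] /=.
- by rewrite (subsetP sY) // => vwe; left; apply/exists_inP; exists e.
- rewrite (disjointFl hE (subsetP sZ _ eZ)) => vwe.
  by right; apply/exists_inP; exists e.
- by exists e; rewrite ?inE ?eS // (subsetP sY).
- by exists e; rewrite ?inE ?eS ?orbT // (disjointFl hE (subsetP sZ _ eS)).
Qed.

(** A vertex of [K] incident with an edge of [H] lies in the interface, so no
    edge of [H] touches a component of [K] that avoids it. *)
Lemma comp_union_free v : v \in vset K -> [disjoint comp K Y v & U] ->
  comp (union K H) (Y :|: Z) v = comp K Y v.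
Proof.
move=> vK dU; apply: comp_local => w z wA; rewrite adj_union.
have [/(adj_vset sZ)/andP[wH _] | _] := boolP (adj H Z w z); last by rewrite orbF.
have wK := subsetP (comp_sub_vset sY vK) _ wA.
by have := disjointFr dU wA; rewrite -hV inE wK wH.
Qed.

Lemma comp_sub_union v : comp K Y v \subset comp (union K H) (Y :|: Z) v.
Proof.
apply: comp_subclosed (comp_refl _ _ _) _ => w z wA wz.
by apply: comp_step wA _; rewrite adj_union wz.
Qed.

End Gluing.

Section GluingComponents.
Variables (K H : mgraph T E) (U : {set T}) (Y Z : {set E}).
Hypotheses (hV : vset K :&: vset H = U) (hE : [disjoint eset K & eset H]).
Hypotheses (sY : Y \subset eset K) (sZ : Z \subset eset H).

(** Gluing is symmetric up to the order of the two graphs: the union of [K]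
    and [H] and that of [H] and [K] have the same adjacency. *)
Lemma comp_unionC v :
  comp (union K H) (Y :|: Z) v = comp (union H K) (Z :|: Y) v.
Proof.
by apply: comp_local => w z _; rewrite !adj_union // 1?disjoint_sym // orbC.
Qed.

Lemma free_comps_union :
  free_comps U (union K H) (Y :|: Z) = free_comps U K Y :|: free_comps U H Z.
Proof.
have hV' : vset H :&: vset K = U by rewrite setIC.
have hE' : [disjoint eset H & eset K] by rewrite disjoint_sym.
apply/setP=> A; apply/free_compsP/setUP=> [[v [/setUP[vK|vH] -> dU]] | ].
- have dK := disjointWl (comp_sub_union hE sY sZ v) dU.
  by left; apply/free_compsP; exists v; rewrite (comp_union_free hV).
- rewrite comp_unionC in dU *.
  have dH := disjointWl (comp_sub_union hE' sZ sY v) dU.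
  by right; apply/free_compsP; exists v; rewrite (comp_union_free hV').
- case=> /free_compsP[v [vG -> dU]]; exists v; split; rewrite ?inE ?vG ?orbT //.
    by rewrite (comp_union_free hV).
  by rewrite comp_unionC (comp_union_free hV').
Qed.

(** No component is counted twice: a free component of [K] that were one of
    [H] would lie in [V(K) :&: V(H) = U], which it avoids. *)
Lemma card_free_comps_union :
  #|free_comps U (union K H) (Y :|: Z)|
    = (#|free_comps U K Y| + #|free_comps U H Z|)%N.
Proof.
rewrite free_comps_union cardsU.
have -> : free_comps U K Y :&: free_comps U H Z = set0; last by rewrite cards0 subn0.
apply/setP=> A; rewrite [RHS]inE; apply/negP=> /setIP[].
case/free_compsP=> v [vK -> dU] /free_compsP[w [wH eqA _]].
have vH : v \in vset H.
  by rewrite (subsetP (comp_sub_vset sZ wH)) // -eqA comp_refl.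
by have := disjointFr dU (comp_refl K Y v); rewrite -hV inE vK vH.
Qed.

End GluingComponents.

(** If neither side joins [u1] to [u2], the two components of [u1] meet the
    interface in [u1] alone, so their union is closed in the glued graph. *)
Lemma connect_union K H u1 u2 Y Z :
    vset K :&: vset H = [set u1; u2] -> [disjoint eset K & eset H] ->
    Y \subset eset K -> Z \subset eset H ->
  connect (adj (union K H) (Y :|: Z)) u1 u2
    = connect (adj K Y) u1 u2 || connect (adj H Z) u1 u2.
Proof.
move=> hV hE sY sZ; have adjU := adj_union hE sY sZ.
have inV u : (u \in vset K) && (u \in vset H) = (u == u1) || (u == u2).
  by rewrite -in_setI hV !inE.
have /andP[u1K u1H] : (u1 \in vset K) && (u1 \in vset H) by rewrite inV eqxx.
apply/idP/orP=> [c12 | [] c12]; last 2 first.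
- by apply: connect_sub c12 => v w vw; rewrite connect1 // adjU vw.
- by apply: connect_sub c12 => v w vw; rewrite connect1 // adjU vw orbT.
apply/orP; apply: contraLR c12; rewrite negb_or => /andP[nK nH].
have subA : comp (union K H) (Y :|: Z) u1 \subset comp K Y u1 :|: comp H Z u1.
  apply: comp_subclosed => [|w z]; first by rewrite inE comp_refl.
  rewrite adjU => /setUP[wA|wA] /orP[wz|wz]; apply/setUP.
  - by left; apply: comp_step wA wz.
  - right; have wH : w \in vset H by case/andP: (adj_vset sZ wz).
    have wK := subsetP (comp_sub_vset sY u1K) _ wA.
    have := inV w; rewrite wK wH => /esym/orP[]/eqP ew; subst w.
      exact: comp_step (comp_refl _ _ _) wz.
    by move: wA; rewrite inE (negbTE nK).
  - left; have wK : w \in vset K by case/andP: (adj_vset sY wz).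
    have wH := subsetP (comp_sub_vset sZ u1H) _ wA.
    have := inV w; rewrite wK wH => /esym/orP[]/eqP ew; subst w.
      exact: comp_step (comp_refl _ _ _) wz.
    by move: wA; rewrite inE (negbTE nH).
  - by right; apply: comp_step wA wz.
apply/negP=> c12; have /(subsetP subA) : u2 \in comp (union K H) (Y :|: Z) u1.
  by rewrite inE.
by rewrite !inE (negbTE nK) (negbTE nH).
Qed.

(** * State sums by free weight *)

Lemma mulr_regroup (R : comNzRingType) (a a' b b' c c' : R) :
  a * a' * (b * b') * (c * c') = a * b * c * (a' * b' * c').
Proof. by ring. Qed.

Lemma joined_expand (R : comNzRingType) (t c d c' d' : R) :
  c * (c' * t + d' * t) + d * (c' * t + d' * t ^+ 2)
    = (c * c' + c * d' + d * c') * t + d * d' * t ^+ 2.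
Proof. by ring. Qed.

Definition free_weight U G Y : {mpoly int[3]} :=
  tI ^+ #|free_comps U G Y| * xI ^+ #|Y| * yI ^+ #|eset G :\: Y|.

Lemma statesum_free_weight U G : statesum G =
  \sum_(Y : {set E} | Y \subset eset G)
     free_weight U G Y * tI ^+ #|comp G Y @: (U :&: vset G)|.
Proof.
apply: eq_bigr => Y sY; rewrite (ncomp_free_anchored U sY) exprD /free_weight.
by rewrite -!mulrA; congr (_ * _); rewrite mulrC -!mulrA.
Qed.

Lemma free_weight_union K H U Y Z :
    vset K :&: vset H = U -> [disjoint eset K & eset H] ->
    Y \subset eset K -> Z \subset eset H ->
  free_weight U (union K H) (Y :|: Z) = free_weight U K Y * free_weight U H Z.
Proof.
move=> hV hE sY sZ; rewrite /free_weight card_free_comps_union //=.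
have cardU (A B : {set E}) : A \subset eset K -> B \subset eset H ->
    #|A :|: B| = (#|A| + #|B|)%N.
  move=> sA sB; rewrite cardsU disjoint_setI0 ?cards0 ?subn0 //.
  exact: disjointWl sA (disjointWr sB hE).
have -> : (eset K :|: eset H) :\: (Y :|: Z)
    = (eset K :\: Y) :|: (eset H :\: Z).
  apply/setP=> e; rewrite !inE.
  have [eK | /negbTE eK] := boolP (e \in eset K).
    have eH := disjointFr hE eK.
    by rewrite eH (contraFF (subsetP sZ e) eH) !orbF.
  by rewrite (contraFF (subsetP sY e) eK).
rewrite !cardU ?subsetDl // !exprD.
exact: mulr_regroup.
Qed.

(** The restrictions of a state to the two edge sets give the inverse of
    [(Y, Z) |-> Y :|: Z]. *)
Lemma sum_states_union (R : nmodType) K H (F : {set E} -> R) :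
    [disjoint eset K & eset H] ->
  \sum_(X : {set E} | X \subset eset (union K H)) F X =
  \sum_(Y : {set E} | Y \subset eset K)
    \sum_(Z : {set E} | Z \subset eset H) F (Y :|: Z).
Proof.
move=> hE; rewrite pair_big /=.
rewrite (reindex_onto (fun p => p.1 :|: p.2)
           (fun X => (X :&: eset K, X :&: eset H))) /=; last first.
  by move=> X sX; rewrite -setIUr; apply/setIidPl.
apply: eq_bigl => -[Y Z] /=; rewrite !setIUl xpair_eqE.
apply/andP/andP=> [[_ /andP[/eqP<- /eqP<-]] | [sY sZ]].
  by split; rewrite subUset !subsetIr // ?andbT.
have dYH := disjointWl sY hE; have dZK : [disjoint Z & eset K].
  by rewrite disjoint_sym (disjointWr sZ).
rewrite (setIidPl sY) (setIidPl sZ) (disjoint_setI0 dYH) (disjoint_setI0 dZK).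
by rewrite setU0 set0U !eqxx setUSS.
Qed.

Definition joined_sum u1 u2 (b : bool) G : {mpoly int[3]} :=
  \sum_(Y : {set E} | (Y \subset eset G) && (connect (adj G Y) u1 u2 == b))
    free_weight [set u1; u2] G Y.

Lemma sum_by_joined u1 u2 G (F : bool -> {mpoly int[3]}) :
  \sum_(Y : {set E} | Y \subset eset G)
     free_weight [set u1; u2] G Y * F (connect (adj G Y) u1 u2) =
  joined_sum u1 u2 true G * F true + joined_sum u1 u2 false G * F false.
Proof.
rewrite (bigID (fun Y => connect (adj G Y) u1 u2)) /= !big_distrl /=.
congr (_ + _); apply: eq_big => Y; rewrite ?eqb_id ?eqbF_neg //.
  by case/andP=> _ ->.
by case/andP=> _ /negbTE->.
Qed.

Lemma card_anchored G Y u1 u2 : [set u1; u2] \subset vset G ->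
  #|comp G Y @: ([set u1; u2] :&: vset G)|
    = if connect (adj G Y) u1 u2 then 1%N else 2%N.
Proof.
move/setIidPl->; rewrite imsetU1 imset_set1 cards2.
by case: (comp_eqP G Y u1 u2) => [->|/eqP->]; rewrite ?eqxx.
Qed.

Lemma statesum_joined u1 u2 G : [set u1; u2] \subset vset G ->
  statesum G = joined_sum u1 u2 true G * tI + joined_sum u1 u2 false G * tI ^+ 2.
Proof.
move=> sU; rewrite (statesum_free_weight [set u1; u2]).
rewrite -(sum_by_joined _ _ _ (fun b => if b then tI else tI ^+ 2)).
by apply: eq_bigr => Y _; rewrite card_anchored //; case: ifP.
Qed.

(** The only vertex of [U] left after the identification is [rep U u1]. *)
Lemma statesum_identify u1 u2 G : u1 \in vset G ->
  statesum (identify G [set u1; u2])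
    = joined_sum u1 u2 true G * tI + joined_sum u1 u2 false G * tI.
Proof.
set U := [set u1; u2] => u1G; rewrite (statesum_free_weight U).
rewrite -(sum_by_joined _ _ _ (fun=> tI)).
have u1U : u1 \in U by rewrite !inE eqxx.
have anchor : U :&: vset (identify G U) = [set rep U u1].
  apply/setP=> w; rewrite in_set1; apply/setIP/eqP=> [[wU /imsetP[a _ defw]] | ->].
    have [aU | aU] := boolP (a \in U); first by rewrite defw (rep_eq aU u1U).
    by move: wU; rewrite defw rep_out // (negbTE aU).
  by split; [apply: rep_in | apply: imset_f].
apply: eq_bigr => Y _.
by rewrite anchor imset_set1 cards1 /free_weight free_comps_identify.
Qed.

Lemma statesum_union u1 u2 K H :
    vset K :&: vset H = [set u1; u2] -> [disjoint eset K & eset H] ->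
  let c G := joined_sum u1 u2 true G in let d G := joined_sum u1 u2 false G in
  statesum (union K H)
    = (c K * c H + c K * d H + d K * c H) * tI + d K * d H * tI ^+ 2.
Proof.
move=> hV hE c d; have sU : [set u1; u2] \subset vset (union K H).
  by rewrite -hV /= subIset // subsetUl.
pose tt b : {mpoly int[3]} := if b then tI else tI ^+ 2.
rewrite (statesum_free_weight [set u1; u2]) sum_states_union //.
transitivity (\sum_(Y : {set E} | Y \subset eset K)
    free_weight [set u1; u2] K Y *
      (fun b => c H * tI + d H * tt b) (connect (adj K Y) u1 u2)).
  apply: eq_bigr => Y sY.
  have := sum_by_joined u1 u2 H (fun b => tt (connect (adj K Y) u1 u2 || b)).
  rewrite orbT orbF => <-; rewrite big_distrr; apply: eq_bigr => Z sZ.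
  rewrite free_weight_union // card_anchored // connect_union // -mulrA.
  by rewrite /tt; case: (_ || _).
rewrite (sum_by_joined _ _ _ (fun b => c H * tI + d H * tt b)) /tt -/(c K) -/(d K).
exact: joined_expand.
Qed.

End Components.

(** * The gluing formula *)

Lemma gluing_identity (F : fieldType) (t c d c' d' : F) :
    t != 0 -> t - 1 != 0 ->
  let k := c * t + d * t ^+ 2 in let k1 := c * t + d * t in
  let h := c' * t + d' * t ^+ 2 in let h1 := c' * t + d' * t in
  (c * c' + c * d' + d * c') * t + d * d' * t ^+ 2 =
    k1 * h1 / (t - 1) - k1 * h / (t * (t - 1)) - k * h1 / (t * (t - 1))
      + k * h / (t * (t - 1)).
Proof. by move=> t0 t1 /=; field; rewrite t0 t1. Qed.

Lemma tI_neq0 : tI != 0.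
Proof.
apply/eqP=> /(congr1 (meval (fun=> 1))).
by rewrite mevalXU meval0.
Qed.

Lemma tI_sub1_neq0 : tI - 1 != 0.
Proof.
apply/eqP=> /(congr1 (meval (fun=> 0))).
by rewrite mevalB mevalXU meval1 meval0.
Qed.

Theorem corollary6p3
    (f : forall T E : finType, mgraph T E -> {mpoly int[3]})
    (hf : is_negami f)
    (T E : finType) (K H : mgraph T E) (u1 u2 : T)
    (hu : u1 != u2)
    (hV : vset K :&: vset H = [set u1; u2])
    (hE : [disjoint eset K & eset H]) :
  let F (G : mgraph T E) : {fraction {mpoly int[3]}} := (f T E G)%:F in
  let t : {fraction {mpoly int[3]}} := tI%:F in
  let U := [set u1; u2] in
  F (union K H) =
      F (identify K U) * F (identify H U) / (t - 1)
    - F (identify K U) * F H / (t * (t - 1))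
    - F K * F (identify H U) / (t * (t - 1))
    + F K * F H / (t * (t - 1)).
Proof.
move=> F t U; rewrite /F !(negami_unique hf statesum_negami).
have sK : U \subset vset K by rewrite /U -hV subsetIl.
have sH : U \subset vset H by rewrite /U -hV subsetIr.
have u1U : u1 \in U by rewrite !inE eqxx.
rewrite (statesum_union hV hE) !(statesum_identify u2) ?(subsetP sK, subsetP sH) //.
rewrite (statesum_joined sK) (statesum_joined sH).
rewrite !(tofracD, tofracM, tofracXn); apply: gluing_identity.
  by rewrite tofrac_eq0 tI_neq0.
by rewrite /t -tofrac1 -tofracB tofrac_eq0 tI_sub1_neq0.
Qed.
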